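(* For every Polish space $\mathcal{X}$ and every ordinal $1\le\xi<\omega_1$ there exists a $\boldsymbol{\Sigma}^0_{\mathrm{apb}(\xi)}$-measurable function \[ c^{\mathcal{X}}_\xi : \mathrm{BC}_\xi \to \mathcal{N} \] such that the set \[ \mathrm{B}^{\mathcal{X}}_\xi(\alpha) \,\triangle\, \mathrm{U}^{\mathcal{X}}(c^{\mathcal{X}}_\xi(\alpha)) \] is meager for all $\alpha\in\mathrm{BC}_\xi$. Moreover, one can choose the family $(c^{\mathcal{X}}_\xi)_{1\le\xi<\omega_1}$ in such a way that $c^{\mathcal{X}}_\xi\upharpoonright\mathrm{BC}_\eta = c^{\mathcal{X}}_\eta$ for all $2\le\eta<\xi$.
   Context: Notation. $\omega=\{0,1,2,\dots\}$, $\omega_1$ is the first uncountable ordinal, $\mathcal{N}=\omega^\omega$ is the Baire space with the product topology, $\triangle$ is symmetric difference. For $P\subseteq X\times Y$ and $x\in X$, the section $\{y : (x,y)\in P\}$ is denoted $P(x)$; we write $P(x,y)$ for $(x,y)\in P$. For $\alpha\in\mathcal{N}$, $\alpha^\ast=(i\mapsto\alpha(i+1))$. A Polish space is a (nonempty) separable completely metrizable topological space. $\boldsymbol{\Sigma}^0_\xi,\boldsymbol{\Pi}^0_\xi$ ($1\le\xi<\omega_1$) are the usual Borel classes. Measurability. If $\Gamma$ is a class of subsets of Polish spaces, $\mathcal{X},\mathcal{Y}$ are Polish, and $\emptyset\ne A\subseteq\mathcal{X}$, a function $f:A\to\mathcal{Y}$ is $\Gamma$-measurable if for every open $V\subseteq\mathcal{Y}$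 there is a set $W\subseteq\mathcal{X}$ in $\Gamma$ with $f^{-1}[V]=W\cap A$. Coding of finite sequences. For $n\ge 1$, $\langle u_0,\dots,u_{n-1}\rangle = p_0^{u_0+1}\cdots p_{n-1}^{u_{n-1}+1}$, where $p_0<p_1<\dots$ are the primes; $\langle\emptyset\rangle=1$. If $s=\langle u_0,\dots,u_{n-1}\rangle$ and $i<n$, then $(s)_i:=u_i$; if $i\ge n$ or $s$ is not in the image of $\langle\cdot\rangle$, then $(s)_i:=0$. Put $q_k=(k)_0/((k)_1+1)$. Basic open sets. For every Polish space $\mathcal{X}$ (including products) a compatible metric $d_{\mathcal{X}}$ and a dense sequence $(r^{\mathcal{X}}_i)_{i\in\omega}$ are fixed (a recursive presentation when the space is recursively presented, such as $\omega\times\omega$), and $N(\mathcal{X},s)$ is the open $d_{\mathcal{X}}$-ball with center $r^{\mathcal{X}}_{(s)_0}$ and radius $q_{(s)_1}$ (empty if the radius is $0$). For $\mathcal{N}$ the choice is: $d_{\mathcal{N}}(\alpha,\beta)=(n+1)^{-1}$ with $n$ least such that $\alpha(n)\ne\beta(n)$ if $\alpha\ne\beta$, $d_{\mathcal{N}}(\alpha,\alpha)=0$, and $r^{\mathcal{N}}_s(i)=(s)_i$. Open codes. $\mathrm{U}^{\mathcal{X}}\subseteq\mathcal{N}\times\mathcal{X}$ is defined by $\mathrm{U}^{\mathcal{X}}(\alpha,x)\iff(\exists n\in\omega)[x\in N(\mathcal{X},\alpha(n))]$. Partial functions $\{\alpha\}$. For $\alpha\in\mathcal{N}$ let $\{\alpha\}:\omega\rightharpoonup\mathcal{N}$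 be the partial function such that $\{\alpha\}(n)$ is defined (written $\{\alpha\}(n)\downarrow$) exactly when there is a unique $\beta\in\mathcal{N}$ such that for all $s\in\omega$: $\beta\in N(\mathcal{N},s)\iff\mathrm{U}^{\omega\times\omega}(\alpha,(n,s))$; in that case $\{\alpha\}(n)$ is this $\beta$. Borel codes. Define $\mathrm{BC}_\xi\subseteq\mathcal{N}$ for $\xi<\omega_1$ by recursion: $\alpha\in\mathrm{BC}_0\iff\alpha(0)=0$; and for $\xi\geq 1$, $\alpha\in\mathrm{BC}_\xi\iff\alpha(0)=1$ and for every $n$ there is $\zeta<\xi$ with $\{\alpha^\ast\}(n)\downarrow$ and $\{\alpha^\ast\}(n)\in\mathrm{BC}_\zeta$. (One has $\mathrm{BC}_\zeta\subseteq\mathrm{BC}_\xi$ for $1\le\zeta\le\xi$.) Let $\mathrm{BC}=\bigcup_{\xi<\omega_1}\mathrm{BC}_\xi$ and for $\alpha\in\mathrm{BC}$ let $|\alpha|$ be the least $\xi$ with $\alpha\in\mathrm{BC}_\xi$. For a Polish space $\mathcal{X}$ define by recursion, for $\alpha\in\mathrm{BC}_\xi$, $\pi^{\mathcal{X}}_0(\alpha)=\mathcal{X}\setminus N(\mathcal{X},\alpha(1))$, and for $\xi\ge 1$, $\pi^{\mathcal{X}}_\xi(\alpha)=\bigcup_{n}\bigl(\mathcal{X}\setminus\pi^{\mathcal{X}}_{|\{\alpha^\ast\}(n)|}(\{\alpha^\ast\}(n))\bigr)$. Put $\pi^{\mathcal{X}}(\alpha)=\pi^{\mathcal{X}}_{|\alpha|}(\alpha)$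 for $\alpha\in\mathrm{BC}$, and define $\mathrm{B}^{\mathcal{X}}_\xi\subseteq\mathcal{N}\times\mathcal{X}$ by $\mathrm{B}^{\mathcal{X}}_\xi(\alpha,x)\iff\alpha\in\mathrm{BC}_\xi$ and $x\in\pi^{\mathcal{X}}(\alpha)$. The sections of $\mathrm{B}^{\mathcal{X}}_\xi$ at points of $\mathrm{BC}_\xi$ ($\xi\geq1$) are exactly the $\boldsymbol{\Sigma}^0_\xi$ subsets of $\mathcal{X}$. The functions $\mathrm{rbc},\mathrm{apb}:\omega_1\setminus\{0\}\to\omega_1\setminus\{0\}$. $\mathrm{rbc}(\xi)$ is the least $\eta<\omega_1$ such that $\mathrm{BC}_\xi$ is a $\boldsymbol{\Pi}^0_\eta$ subset of $\mathcal{N}$. $\mathrm{apb}(1)=1$, and for $\xi>1$, $\mathrm{apb}(\xi)=\sup\{\max\{\mathrm{apb}(\eta),\mathrm{rbc}(\eta)+1\} : 1\le\eta<\xi\}+1$. *)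

(* Defs.v *)
From HB Require Import structures.
From mathcomp Require Import all_boot all_order all_algebra.
From mathcomp Require Import all_classical all_reals all_analysis.
From mathcomp Require wochoice.
Set Implicit Arguments.
Unset Strict Implicit.
Unset Printing Implicit Defensive.
Import Order.TTheory GRing.Theory Num.Theory.
Local Open Scope classical_set_scope.
Local Open Scope ring_scope.

(* The first uncountable ordinal, characterized up to isomorphism: an
   uncountable well-order all of whose proper initial segments are countable.
   It has a model, see [omega1_inhabited]. *)
Record omega1 := Omega1 {
  omega1_disp : Order.disp_t ;
  omega1_sort :> orderType omega1_disp ;
  omega1_wf : well_founded (fun x y : omega1_sort => (x < y)%O) ;
  omega1_uncountable : ~ countable [set: omega1_sort] ;
  omega1_countable : forall x : omega1_sort, countable [set y | (y < x)%O] }.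

Module Omega1Model.

Definition R : rel (set nat) :=
  sval (wochoice.well_ordering_principle (set nat)).

Lemma minR (A : set (set nat)) : A !=set0 ->
  exists2 z, A z & forall x, A x -> R z x.
Proof.
move=> [x Ax]; pose p : {pred set nat} := [pred y | `[< A y >]].
have [z [[/asboolP Az zP] _]] := proj2_sig
  (wochoice.well_ordering_principle (set nat)) p
  (ex_intro _ x (introT (asboolP _) Ax)).
by exists z => // y Ay; apply: zP; apply/asboolP.
Qed.

Lemma R_total : total R.
Proof.
move=> x y; have [|z [->|->] zP] := @minR [set x; y]; first by exists x; left.
  by rewrite zP //; right.
by apply/orP; right; apply: zP; left.
Qed.

Lemma R_refl : reflexive R.
Proof. by move=> x; have := R_total x x; rewrite orbb. Qed.

Lemma R_anti : antisymmetric R.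
Proof.
move=> x y /andP[xy yx]; pose p : {pred set nat} := pred2 x y.
have xp : x \in p by rewrite inE eqxx.
have yp : y \in p by rewrite inE eqxx orbT.
have [z [_ zU]] := proj2_sig
  (wochoice.well_ordering_principle (set nat)) p (ex_intro _ x xp).
rewrite -(zU x); last first.
  by split=> // w; rewrite inE => /orP[] /eqP -> //; exact: R_refl.
by apply: zU; split=> // w; rewrite inE => /orP[] /eqP -> //; exact: R_refl.
Qed.

Lemma R_trans : transitive R.
Proof.
move=> y x z xy yz.
have [|m mA mP] := @minR [set u | [\/ u = x, u = y | u = z]].
  by exists x; constructor 1.
case: mA => e; subst m.
- by apply: mP; constructor 3.
- by rewrite (R_anti (y := y) (x := x)) // xy mP //; constructor 1.
- by rewrite -(R_anti (x := y) (y := z)) // yz mP //; constructor 2.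
Qed.

Definition good : {pred set nat} :=
  [pred y | `[< countable [set z | R z y /\ z <> y] >]].

Definition T := {y : set nat | y \in good}.
HB.instance Definition _ := Choice.on T.
Definition leT (x y : T) := R (val x) (val y).

Lemma leT_refl : reflexive leT. Proof. by move=> x; exact: R_refl. Qed.
Lemma leT_anti : antisymmetric leT.
Proof. by move=> x y /R_anti /val_inj. Qed.
Lemma leT_trans : transitive leT. Proof. by move=> y x z; exact: R_trans. Qed.

HB.instance Definition _ := Order.Le_isPOrder.Build Order.default_display T
  leT_refl leT_anti leT_trans.
Lemma leT_total : total (<=%O : rel T). Proof. by move=> x y; exact: R_total. Qed.
HB.instance Definition _ := Order.POrder_isTotal.Build _ T leT_total.

Lemma ltTE (x y : T) : (x < y)%O <-> R (val x) (val y) /\ val x <> val y.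
Proof.
rewrite lt_neqAle; split=> [/andP[/eqP xy h]|[h xy]].
  by split => // /val_inj.
by apply/andP; split => //; apply/eqP => e; apply: xy; rewrite e.
Qed.

Lemma wfT : well_founded (fun x y : T => (x < y)%O).
Proof.
move=> x; apply: contrapT => nx.
have [|z [y nAy <-] zP] := @minR
  (val @` [set y : T | ~ Acc (fun x y : T => (x < y)%O) y]).
  by exists (val x), x.
apply: nAy; constructor => w wy; apply: contrapT => nw.
have : (y <= w)%O by apply: zP; exists w.
by rewrite leNgt wy.
Qed.

Lemma segT (x : T) : countable [set y | (y < x)%O].
Proof.
have /asboolP := valP x; apply: sub_countable.
have /card_eqPle[_ /card_le_trans] : (val @` [set y : T | (y < x)%O] #=
    [set y : T | (y < x)%O])%card by apply: inj_card_eq => u v _ _; exact: val_inj.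
by apply; apply: subset_card_le => _ [y yx <-]; exact/ltTE.
Qed.

Lemma uncT : ~ countable [set: T].
Proof.
move=> cT.
have [all|/existsNP[y ny]] := pselect (forall y, y \in good).
  have : countable [set: set nat].
    apply: sub_countable cT.
    apply: (@card_le_trans _ _ _ (val @` [set: T])); last exact: card_image_le.
    by apply: subset_card_le => y _; exists (exist _ y (all y)).
  move=> /countable_injP[f finj].
  pose D : set nat := [set n | exists A, f A = n /\ ~ A n].
  have [DD|nDD] := pselect (D (f D)).
    have [A [fA nA]] := DD.
    by apply: nA; rewrite (finj A D) ?inE //; exact: fA.
  by apply: (nDD); exists D; split.
have [|z nz zP] := @minR [set y | ~ y \in good]; first by exists y.
apply: nz; apply/asboolP; apply: sub_countable cT.
apply: (@card_le_trans _ _ _ (val @` [set: T])); last exact: card_image_le.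
apply: subset_card_le => u [uz nuz].
have [gu|ngu] := pselect (u \in good); first by exists (exist _ u gu).
by case: nuz; apply: R_anti; rewrite uz zP.
Qed.

Lemma inhab : inhabited omega1.
Proof. by constructor; exact: (Omega1 wfT uncT segT). Qed.

End Omega1Model.

Lemma omega1_inhabited : inhabited omega1.
Proof. exact: Omega1Model.inhab. Qed.

Section Ordinals.
Variable W : omega1.
Implicit Types (xi eta : W) (A : set W).

Lemma omega1_nonempty : exists xi : W, True.
Proof.
apply: contrapT => nW; apply: (@omega1_uncountable W).
suff -> : [set: W] = set0 by [].
by apply/seteqP; split => // x _; apply: nW; exists x.
Qed.

(* unspecified when A is empty *)
Definition oleast A : W :=
  xget (projT1 (cid omega1_nonempty))
    [set xi | A xi /\ forall eta, A eta -> (xi <= eta)%O].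

Definition ozero : W := oleast setT.
Definition osucc xi : W := oleast [set eta | (xi < eta)%O].
Definition osup A : W := oleast (ubound A).
Definition oone : W := osucc ozero.
Definition otwo : W := osucc oone.

Lemma oleastP A : A !=set0 ->
  A (oleast A) /\ forall eta, A eta -> (oleast A <= eta)%O.
Proof.
move=> [x Ax]; rewrite /oleast; case: xgetP => // noleast; exfalso.
elim/(well_founded_ind (@omega1_wf W)): x Ax => x IH Ax.
apply: (noleast x); split=> // y Ay; rewrite leNgt; apply/negP => yx.
exact: IH yx Ay.
Qed.

(* Transfinite recursion: [orec dflt F xi] is [F xi] applied to the values of
   [orec dflt F] at the predecessors of xi, extended by dflt (see [orecE]). *)
Definition orec (T : Type) (dflt : T) (F : W -> (W -> T) -> T) : W -> T :=
  Fix (@omega1_wf W) (fun _ => T)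
    (fun xi rec => F xi (fun zeta =>
       if pselect (zeta < xi)%O is left h then rec zeta h else dflt)).

Lemma orecE (T : Type) (dflt : T) (F : W -> (W -> T) -> T) xi :
  orec dflt F xi =
  F xi (fun zeta => if (zeta < xi)%O then orec dflt F zeta else dflt).
Proof.
rewrite /orec Fix_eq; last first.
  move=> x f g fg; congr (F x _); apply/funext => z.
  by case: pselect => // h; exact: fg.
congr (F xi _); apply/funext => z.
by case: pselect => [->|/negP/negbTE ->].
Qed.

End Ordinals.

Arguments ozero {W}.
Arguments oone {W}.
Arguments otwo {W}.

Section Topology.
Variables (R : realType) (X : topologicalType).

Definition is_metric (d : X -> X -> R) : Prop :=
  [/\ forall x y, 0 <= d x y,
      forall x y, d x y = 0 <-> x = y,
      forall x y, d x y = d y x &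
      forall x y z, d x z <= d x y + d y z].

Definition compatible_metric (d : X -> X -> R) : Prop :=
  is_metric d /\
  forall A : set X,
    open A <-> forall x, A x -> exists2 e, 0 < e & [set y | d x y < e] `<=` A.

Definition complete_metric (d : X -> X -> R) : Prop :=
  forall u : nat -> X,
    (forall e, 0 < e -> exists n, forall i j,
       (n <= i)%N -> (n <= j)%N -> d (u i) (u j) < e) ->
    exists x : X, u @ \oo --> x.

Definition polish : Prop :=
  [/\ [set: X] !=set0,
      exists A : set X, countable A /\ dense A &
      exists d : X -> X -> R, compatible_metric d /\ complete_metric d].

Definition nowhere_dense (A : set X) : Prop := (closure A)° = set0.

Definition meager (A : set X) : Prop :=
  exists F : nat -> set X,
    (forall n, nowhere_dense (F n)) /\ A `<=` \bigcup_n F n.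

End Topology.

Section BorelHierarchy.
Variables (W : omega1) (X : topologicalType).

(* meaningful for 1 <= xi only *)
Definition Sigma0 : W -> set (set X) :=
  orec set0 (fun xi S => [set A : set X |
    if (xi <= oone)%O then open A else
      exists (F : nat -> set X) (zeta : nat -> W),
        (forall n, [/\ (oone <= zeta n)%O, (zeta n < xi)%O
                     & S (zeta n) (~` F n)]) /\
        A = \bigcup_n F n]).

Definition Pi0 (xi : W) : set (set X) := [set A | Sigma0 xi (~` A)].

Lemma Sigma0E (xi : W) (A : set X) :
  Sigma0 xi A <->
  if (xi <= oone)%O then open A else
    exists (F : nat -> set X) (zeta : nat -> W),
      (forall n, [/\ (oone <= zeta n)%O, (zeta n < xi)%O
                   & Pi0 (zeta n) (F n)]) /\
      A = \bigcup_n F n.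
Proof.
rewrite /Pi0 {1}/Sigma0 orecE /=; case: ifP => // _.
split=> -[F [z [Fz ->]]]; exists F, z; split=> // n.
  by have [? zx] := Fz n; rewrite zx.
by have [? zx ?] := Fz n; rewrite zx.
Qed.

End BorelHierarchy.

Definition measurable_wrt (X Y : topologicalType) (Gamma : set (set X))
    (A : set X) (f : X -> Y) : Prop :=
  A !=set0 /\
  forall V : set Y, open V ->
    exists2 B : set X, Gamma B & A `&` f @^-1` V = B `&` A.

Section Coding.

Lemma next_prime_ex n : exists p, (n < p)%N && prime p.
Proof. by have [p np pp] := prime_above n; exists p; rewrite np. Qed.

Fixpoint nth_prime (i : nat) : nat :=
  if i is j.+1 then ex_minn (next_prime_ex (nth_prime j)) else 2%N.

Definition seqcode (u : seq nat) : nat :=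
  (\prod_(i < size u) nth_prime i ^ (nth 0 u i).+1)%N.

(* (s)_i; the default values of xget and nth give 0 when s is not a code or
   i is out of range *)
Definition seqproj (s i : nat) : nat :=
  nth 0%N (xget [::] [set u | seqcode u = s]) i.

Lemma nth_prime_prime i : prime (nth_prime i).
Proof. by case: i => //= i; case: ex_minnP => m /andP[]. Qed.

Lemma nth_prime_mono : {homo nth_prime : i j / (i < j)%N}.
Proof.
by apply: homo_ltn => [|i] /=; [exact: ltn_trans|case: ex_minnP => m /andP[]].
Qed.

Lemma nth_prime_inj : injective nth_prime.
Proof.
move=> i j e; case: (ltngtP i j) => // /nth_prime_mono; by rewrite e ltnn.
Qed.

Lemma logn_seqcode (u : seq nat) i :
  logn (nth_prime i) (seqcode u) =
  if (i < size u)%N then (nth 0%N u i).+1 else 0%N.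
Proof.
rewrite /seqcode.
have H (n : nat) (F : nat -> nat) :
  ((0 < \prod_(j < n) nth_prime j ^ F j) /\
  logn (nth_prime i) (\prod_(j < n) nth_prime j ^ F j) = if i < n then F i else 0)%N.
  elim: n => [|n [IH0 IH]]; first by rewrite big_ord0 logn1.
  have p0 : (0 < nth_prime n ^ F n)%N by rewrite expn_gt0 prime_gt0 ?nth_prime_prime.
  rewrite big_ord_recr /= muln_gt0 IH0 p0; split=> //.
  rewrite lognM // IH lognX logn_prime ?nth_prime_prime //.
  rewrite (inj_eq nth_prime_inj).
  by case: (ltngtP i n) => [h|h|->]; rewrite ?muln0 ?muln1 ?addn0 // ltnS
    ?(ltnW h) ?leqnn // leqNgt h.
by have [_ ->] := H (size u) (fun j => (nth 0%N u j).+1).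
Qed.

Lemma seqcode_inj : injective seqcode.
Proof.
move=> u v e.
have E i := logn_seqcode u i; have E' i := logn_seqcode v i.
have L i : (if (i < size u)%N then (nth 0%N u i).+1 else 0%N)
  = if (i < size v)%N then (nth 0%N v i).+1 else 0%N by rewrite -E -E' e.
have S : size u = size v.
  case: (ltngtP (size u) (size v)) => // h.
    by have := L (size u); rewrite ltnn h.
  by have := L (size v); rewrite ltnn h.
apply: (@eq_from_nth _ 0%N) => // i iu.
by have := L i; rewrite -S iu => -[].
Qed.

Lemma seqcodeK (u : seq nat) (i : nat) : seqproj (seqcode u) i = nth 0%N u i.
Proof.
rewrite /seqproj (@xget_unique _ [::] [set v | seqcode v = seqcode u] u) //.
by move=> v /seqcode_inj.
Qed.

Definition qrat (R : realType) (k : nat) : R :=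
  (seqproj k 0)%:R / (seqproj k 1).+1%:R.

End Coding.

(* Raw data; the axioms are in [is_presentation]. *)
Record presentation (R : realType) (X : topologicalType) := Presentation {
  pdist : X -> X -> R ;
  ppoint : nat -> X }.

Section Presentations.
Variables (R : realType) (X : topologicalType) (D : presentation R X).

Definition is_presentation : Prop :=
  compatible_metric (pdist D) /\ dense (range (ppoint D)).

Definition bnbhd (s : nat) : set X :=
  [set x | pdist D (ppoint D (seqproj s 0)) x < qrat R (seqproj s 1)].

End Presentations.

(* [rec_min] only allows minimization with a total result, so that these are
   exactly the total recursive functions. *)
Inductive recursive : forall n : nat, (n.-tuple nat -> nat) -> Prop :=
| rec_zero n : @recursive n (fun=> 0%N)
| rec_succ : @recursive 1 (fun x => (thead x).+1)
| rec_proj n (i : 'I_n) : @recursive n (fun x => tnth x i)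
| rec_comp n m (f : m.-tuple nat -> nat) (g : 'I_m -> n.-tuple nat -> nat) :
    recursive f -> (forall i, recursive (g i)) ->
    @recursive n (fun x => f [tuple g i x | i < m])
| rec_prim n (f : n.-tuple nat -> nat) (g : n.+2.-tuple nat -> nat) :
    recursive f -> recursive g ->
    @recursive n.+1 (fun x =>
      let y := [tuple of behead x] in
      nat_rect (fun=> nat) (f y) (fun k r => g [tuple of k :: r :: y]) (thead x))
| rec_min n (g : n.+1.-tuple nat -> nat) (f : n.-tuple nat -> nat) :
    recursive g ->
    (forall x, g [tuple of f x :: x] = 0%N /\
       forall k, (k < f x)%N -> g [tuple of k :: x] <> 0%N) ->
    recursive f.

Definition recursive_rel (n : nat) (P : n.-tuple nat -> bool) : Prop :=
  recursive (fun x => nat_of_bool (P x)).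

(* The two relations are d(r_i, r_j) < k/(m+1) and d(r_i, r_j) <= k/(m+1), as
   relations in (i, j, k, m). *)
Definition recursive_presentation (R : realType) (X : topologicalType)
    (D : presentation R X) : Prop :=
  [/\ is_presentation D,
      recursive_rel (fun x : 4.-tuple nat =>
        pdist D (ppoint D (tnth x 0)) (ppoint D (tnth x 1))
          < (tnth x 2)%:R / (tnth x 3).+1%:R) &
      recursive_rel (fun x : 4.-tuple nat =>
        pdist D (ppoint D (tnth x 0)) (ppoint D (tnth x 1))
          <= (tnth x 2)%:R / (tnth x 3).+1%:R)].

Definition baire_space : topologicalType := {ptws nat -> nat}.

Definition shift (alpha : baire_space) : baire_space := fun i => alpha i.+1.

Definition baire_dist (R : realType) (alpha beta : baire_space) : R :=
  if pselect (exists n, alpha n != beta n) is left h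
  then ((ex_minn h).+1%:R)^-1 else 0.

Definition baire_presentation (R : realType) : presentation R baire_space :=
  @Presentation R baire_space (@baire_dist R) (fun s => seqproj s).

Lemma nbhs_baireP (alpha : baire_space) (A : set baire_space) :
  nbhs alpha A <->
  exists n, [set beta : baire_space | forall i, (i < n)%N -> beta i = alpha i] `<=` A.
Proof.
pose C n :=
  [set beta : baire_space | forall i, (i < n)%N -> beta i = alpha i].
split.
  pose F := filter_from [set: nat] C.
  have FF : Filter F.
    apply: filter_from_filter; first by exists 0%N.
    move=> i j _ _; exists (maxn i j) => // b bP; split=> k kl; apply: bP.
      by rewrite leq_max kl.
    by rewrite leq_max kl orbT.
  suff Fa : F --> alpha by move=> /Fa [n _ nA]; exists n.
  apply/cvg_sup => i.
  move=> S -[T [[V _ <-] Va VS]].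
  exists i.+1 => // b /(_ i (ltnSn i)) e; apply: VS.
  by rewrite /preimage /= e.
move=> [n nA]; apply: (filterS nA).
elim: n {nA} => [|n IH]; first by apply: filterE => b i.
have /(filterI IH) : nbhs alpha [set b : baire_space | b n = alpha n].
  exact: (@proj_continuous nat (fun=> nat) n alpha [set alpha n]).
apply: filterS => b [bn e] i; rewrite ltnS leq_eqVlt => /orP[/eqP -> //|].
exact: bn.
Qed.

Lemma baire_distE (R : realType) (a b : baire_space) (n : nat) :
  baire_dist R a b < (n.+1%:R)^-1 <-> (forall i, (i <= n)%N -> a i = b i).
Proof.
rewrite /baire_dist; case: pselect => [h|h].
  case: ex_minnP => m hm mP; rewrite ltf_pV2 ?posrE // ltr_nat ltnS.
  split=> [nm i ni|ab].
    apply/eqP; apply: contraT => /mP; rewrite leqNgt.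
    by rewrite (leq_ltn_trans ni nm).
  by rewrite ltnNge; apply/negP => /ab e; move: hm; rewrite e eqxx.
split=> [_ i _|_]; last by rewrite invr_gt0.
by apply: contrapT => /eqP ni; apply: h; exists i.
Qed.

Lemma baire_dist_metric (R : realType) : is_metric (baire_dist R).
Proof.
have ge0 a b : 0 <= baire_dist R a b.
  by rewrite /baire_dist; case: pselect => // h; rewrite invr_ge0.
have sym a b : baire_dist R a b = baire_dist R b a.
  rewrite /baire_dist; case: pselect => [h|h]; case: pselect => [h'|h'] //.
  - congr (_.+1%:R^-1); case: ex_minnP => m hm mP; case: ex_minnP => k hk kP.
    by apply/eqP; rewrite eqn_leq mP 1?eq_sym // kP // eq_sym.
  - by exfalso; apply: h'; have [n] := h; exists n; rewrite eq_sym.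
  - by exfalso; apply: h; have [n] := h'; exists n; rewrite eq_sym.
have val a b : a = b \/ exists n, baire_dist R a b = (n.+1%:R)^-1.
  rewrite /baire_dist; case: pselect => h; first by right; exists (ex_minn h).
  left; apply/funext => n; apply: contrapT => /eqP ab; apply: h; by exists n.
have d0 a : baire_dist R a a = 0.
  by rewrite /baire_dist; case: pselect => // h; exfalso; have [n] := h; rewrite eqxx.
split=> // a b.
  split=> [|->]; last exact: d0.
  have [//|[n ->] /eqP] := val a b.
  by rewrite invr_eq0 pnatr_eq0.
move=> c.
have [->|[n ac]] := val a c; first by rewrite d0 addr_ge0.
rewrite leNgt; apply/negP => h.
have ab : baire_dist R a b < (n.+1%:R)^-1.
  by rewrite -ac; apply: le_lt_trans h; rewrite lerDl.
have bc : baire_dist R b c < (n.+1%:R)^-1.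
  by rewrite -ac; apply: le_lt_trans h; rewrite lerDr.
have : baire_dist R a c < (n.+1%:R)^-1.
  apply/baire_distE => i ni.
  by rewrite (baire_distE R a b n).1 // (baire_distE R b c n).1.
by rewrite ac ltxx.
Qed.

Lemma baire_is_presentation (R : realType) :
  is_presentation (baire_presentation R).
Proof.
split; [split; first exact: baire_dist_metric|].
  move=> A; split=> [oA a Aa|h].
    have /nbhs_baireP[n nA] : nbhs a A by apply: open_nbhs_nbhs.
    exists (n.+1%:R)^-1; first by rewrite invr_gt0.
    move=> b /baire_distE ab; apply: nA => i /ltnW /ab ->. by [].
  rewrite openE => a Aa; rewrite /interior.
  have [e e0 eA] := h a Aa; apply/nbhs_baireP.
  have [n ne] : exists n, (n.+1%:R)^-1 < e.
    exists (Num.bound e^-1); rewrite invf_plt ?posrE //.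
    by apply: lt_trans (archi_boundP _) _; rewrite ?invr_ge0 ?(ltW e0) // ltr_nat.
  exists n.+1 => b ba; apply: eA; apply: lt_trans ne.
  by apply/baire_distE => i ni; rewrite ba.
move=> O [a Oa] oO.
have /nbhs_baireP[n nO] : nbhs a O by apply: open_nbhs_nbhs.
exists (seqproj (seqcode (mkseq a n))); split; last by exists (seqcode (mkseq a n)).
by apply: nO => i i_n; rewrite seqcodeK nth_mkseq.
Qed.

Definition Ucode (R : realType) (X : topologicalType) (D : presentation R X)
    (alpha : baire_space) : set X :=
  [set x | exists n : nat, bnbhd D (alpha n) x].

Section Codes.
Variables (R : realType) (W : omega1).
(* the presentation of omega x omega underlying the partial functions {alpha} *)
Variable P : presentation R (nat * nat)%type.

Definition is_value (alpha : baire_space) (n : nat)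
    (beta : baire_space) : Prop :=
  forall s : nat, bnbhd (baire_presentation R) s beta <-> Ucode P alpha (n, s).

Definition defined (alpha : baire_space) (n : nat) : Prop :=
  exists! beta, is_value alpha n beta.

(* {alpha}(n), meaningful when [defined alpha n] *)
Definition value (alpha : baire_space) (n : nat) : baire_space :=
  xget ((fun=> 0%N) : baire_space) [set beta | is_value alpha n beta].

Definition BC : W -> set baire_space :=
  orec set0 (fun xi S => [set alpha : baire_space |
    if xi == ozero then alpha 0%N = 0%N else
      alpha 0%N = 1%N /\
      forall n, exists zeta : W,
        [/\ (zeta < xi)%O, defined (shift alpha) n
          & S zeta (value (shift alpha) n)]]).

Lemma BCE (xi : W) (alpha : baire_space) :
  BC xi alpha <->
  if xi == ozero then alpha 0%N = 0%N else
    alpha 0%N = 1%N /\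
    forall n, exists zeta : W,
      [/\ (zeta < xi)%O, defined (shift alpha) n
        & BC zeta (value (shift alpha) n)].
Proof.
rewrite {1}/BC orecE /=; case: ifP => // _.
split=> -[a0 h]; split=> // n; have [z [zx d b]] := h n; exists z; split=> //.
  by move: b; rewrite zx.
by rewrite zx.
Qed.

Definition rank (alpha : baire_space) : W := oleast [set xi | BC xi alpha].

Section Interpretation.
Variables (X : topologicalType) (D : presentation R X).

(* meaningful at (xi, alpha) with [BC xi alpha] *)
Definition pi_code : W -> baire_space -> set X :=
  orec (fun=> set0) (fun xi S alpha =>
    if xi == ozero then ~` bnbhd D (alpha 1%N) else
      \bigcup_n ~` S (rank (value (shift alpha) n)) (value (shift alpha) n)).

Lemma rank_lt (xi : W) (alpha : baire_space) (n : nat) :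
  BC xi alpha -> xi != ozero -> (rank (value (shift alpha) n) < xi)%O.
Proof.
move=> /BCE h xi0; move: h; rewrite (negbTE xi0) => -[_ /(_ n)[z [zx _ bz]]].
apply: le_lt_trans zx.
have ne : [set eta | BC eta (value (shift alpha) n)] !=set0 by exists z.
by have [_] := oleastP ne; apply.
Qed.

Lemma pi_codeE (xi : W) (alpha : baire_space) : BC xi alpha ->
  pi_code xi alpha =
  if xi == ozero then ~` bnbhd D (alpha 1%N) else
    \bigcup_n ~` pi_code (rank (value (shift alpha) n)) (value (shift alpha) n).
Proof.
move=> h; rewrite {1}/pi_code orecE; case: ifP => // /negbT xi0.
by apply: eq_bigcupr => n _; rewrite rank_lt.
Qed.

Definition Bcode (xi : W) (alpha : baire_space) : set X :=
  [set x | BC xi alpha /\ pi_code (rank alpha) alpha x].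

End Interpretation.

(* meaningful for 1 <= xi only, as is [apb] *)
Definition rbc (xi : W) : W :=
  oleast [set eta | (oone <= eta)%O /\ Pi0 eta (BC xi)].

Definition apb : W -> W :=
  orec oone (fun xi f =>
    if (xi <= oone)%O then oone else
      osucc (osup [set z | exists eta : W,
        [/\ (oone <= eta)%O, (eta < xi)%O
          & z = Order.max (f eta) (osucc (rbc eta))]])).

Lemma apbE (xi : W) :
  apb xi =
  if (xi <= oone)%O then oone else
    osucc (osup [set z | exists eta : W,
      [/\ (oone <= eta)%O, (eta < xi)%O
        & z = Order.max (apb eta) (osucc (rbc eta))]]).
Proof.
rewrite {1}/apb orecE; case: ifP => // _; congr (osucc (osup _)).
apply/seteqP; split=> z [e [e1 ex ->]]; exists e; split=> //.
  by rewrite ex.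
by rewrite ex.
Qed.

End Codes.

(* Main.v *)
Require Import Defs.
From mathcomp Require Import all_boot all_order all_algebra.
From mathcomp Require Import all_classical all_reals all_analysis.
Set Implicit Arguments.
Unset Strict Implicit.
Unset Printing Implicit Defensive.
Import Order.TTheory GRing.Theory Num.Theory.
Local Open Scope classical_set_scope.
Local Open Scope ring_scope.

(** One function works for all levels at once: define [open_code] by recursion
    on the rank. If [pi(a)] is the union over [n] of the complements of
    [pi(b_n)], then each complement is either a basic open set ([b_n] of rank 0)
    or, modulo a meager set, the exterior of the open set coded by
    [open_code b_n]; [open_code a] enumerates the balls of all these open sets.
    Whether a given ball lies in that exterior is a closed condition on
    [open_code b_n]. For the measurability at level [xi] one splits according to
    the level [eta < xi] with [b_n] in [BC_eta], a [Pi0_(rbc eta)] condition on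
    [b_n], and [a |-> b_n] is continuous on its domain. This needs [rbc] to be
    meaningful, i.e. each [BC_eta] to be Borel. *)

(* [shift] is shadowed by mathcomp-analysis. *)
Local Notation shift := Defs.shift.

Definition unpair (m : nat) : nat * nat := odflt (0%N, 0%N) (unpickle m).

Lemma pickleK_unpair n k : unpair (pickle (n, k)) = (n, k).
Proof. by rewrite /unpair pickleK. Qed.

(** * Bounds and suprema of countable subsets of omega_1 *)

Section Omega1Bounds.
Variable W : omega1.
Implicit Types (xi eta zeta : W) (A : set W).

(** Otherwise the initial segments [x <= y] with [y] in [A] would cover [W], a countable union of
    countable sets. *)
Lemma omega1_bounded A : countable A -> exists xi, forall eta, A eta -> (eta < xi)%O.
Proof.
move=> cA; apply: contrapT => nb; apply: (@omega1_uncountable W).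
have -> : [set: W] = \bigcup_(y in A) ([set x | (x < y)%O] `|` [set y]).
  apply/seteqP; split=> // x _; apply: contrapT => nx; apply: nb.
  exists x => y Ay; rewrite ltNge le_eqVlt; apply/negP => /orP[/eqP xy|xy];
    apply: nx; exists y => //; [by right|by left].
apply: bigcup_countable => // y _.
rewrite -bigcup2E; apply: bigcup_countable => // -[|[|n]] _ /=.
- exact: omega1_countable.
- exact: countable1.
- exact: countable0.
Qed.

Lemma osuccP xi : (xi < osucc xi)%O /\ forall eta, (xi < eta)%O -> (osucc xi <= eta)%O.
Proof.
apply: (@oleastP _ [set eta | (xi < eta)%O]).
by have [eta h] := omega1_bounded (@countable1 _ xi); exists eta; exact: h.
Qed.

Lemma osup_ub A xi : countable A -> A xi -> (xi <= osup A)%O.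
Proof.
move=> /omega1_bounded [b bP] Ax.
have [ub _] : ubound A (osup A) /\ forall eta, ubound A eta -> (osup A <= eta)%O.
  by apply: oleastP; exists b => y /bP /ltW.
exact: ub.
Qed.

Lemma ozero_le xi : (ozero <= xi)%O.
Proof.
have [_ h] := @oleastP W setT (ex_intro _ xi I); exact: h.
Qed.

Lemma oone_leP xi : (oone <= xi)%O = (xi != ozero).
Proof.
have [h0 h1] := osuccP ozero; apply/idP/idP => [h|xi0].
  by rewrite gt_eqF // (lt_le_trans h0).
by apply: h1; rewrite lt_neqAle eq_sym xi0 ozero_le.
Qed.

End Omega1Bounds.

(** Lets unions over initial segments of [W] or over sets of ball indices be treated as sequences;
    numbers that index nothing get the empty set. *)
Lemma bigcup_countable_seq (T U : Type) (I : set T) (F : T -> set U) :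
  countable I ->
  exists G : nat -> set U, \bigcup_(i in I) F i = \bigcup_n G n /\
    forall n, G n = set0 \/ exists2 i, I i & G n = F i.
Proof.
move=> /countable_injP[f finj].
exists (fun n => \bigcup_(i in I `&` [set i | f i = n]) F i); split.
  apply/seteqP; split=> x; first by move=> [i Ii Fx]; exists (f i) => //; exists i.
  by move=> [n _ [i [Ii _] Fx]]; exists i.
move=> n; have [[i [Ii fi]]|ne] := pselect (exists i, I i /\ f i = n); [right|left].
  exists i => //; apply/seteqP; split=> x; last by move=> ?; exists i.
  by move=> [j [Ij fj]]; rewrite (finj i j) ?inE // fi fj.
by apply/seteqP; split=> // x [j [Ij fj] _]; apply: ne; exists j.
Qed.

(** * Closure properties of the Borel classes *)

Section Hierarchy.
Variables (W : omega1) (X : topologicalType).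
Hypothesis open_Fsigma : forall A : set X, open A ->
  exists F : nat -> set X, (forall n, closed (F n)) /\ A = \bigcup_n F n.
Implicit Types (xi eta zeta : W) (A B : set X).

Lemma Sigma0_oone A : Sigma0 (oone : W) A <-> open A.
Proof. by rewrite Sigma0E lexx. Qed.

Lemma Pi0_Sigma0 zeta xi A : (oone <= zeta)%O -> (zeta < xi)%O ->
  Pi0 zeta A -> Sigma0 xi A.
Proof.
move=> z1 zx PA; apply/Sigma0E; rewrite leNgt (le_lt_trans z1 zx) /=.
by exists (fun=> A), (fun=> zeta); split=> //; rewrite bigcup_const //; exists 0%N.
Qed.

(** Above [oone], a decomposition witnessing level [zeta] also witnesses level [xi]; only the
    passage out of the open sets rests on [open_Fsigma]. *)
Lemma Sigma0_le zeta xi A : (oone <= zeta)%O -> (zeta <= xi)%O ->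
  Sigma0 zeta A -> Sigma0 xi A.
Proof.
move=> z1; rewrite le_eqVlt => /orP[/eqP <- //|zx].
move=> /Sigma0E; case: ifPn => [z1' oA|]; last first.
  rewrite -ltNge => _ [F [z [Fz ->]]]; apply/Sigma0E.
  rewrite leNgt (le_lt_trans z1 zx) /=; exists F, z; split=> // n.
  by have [? zz ?] := Fz n; split=> //; exact: lt_trans zx.
apply/Sigma0E; rewrite leNgt (le_lt_trans z1 zx) /=.
have [F [cF ->]] := open_Fsigma oA.
exists F, (fun=> oone); split=> // n; split; rewrite ?(le_lt_trans z1 zx) //.
by rewrite /Pi0 /= Sigma0_oone openC.
Qed.

Lemma Pi0_le zeta xi A : (oone <= zeta)%O -> (zeta <= xi)%O ->
  Pi0 zeta A -> Pi0 xi A.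
Proof. exact: Sigma0_le. Qed.

Lemma Sigma0_open xi A : (oone <= xi)%O -> open A -> Sigma0 xi A.
Proof. by move=> x1 /Sigma0_oone; exact: Sigma0_le. Qed.

Lemma Sigma0_bigcup xi (F : nat -> set X) : (oone <= xi)%O ->
  (forall n, Sigma0 xi (F n)) -> Sigma0 xi (\bigcup_n F n).
Proof.
move=> x1; have [x1'|x1'] := leP xi oone.
  have -> : xi = oone by apply/le_anti; rewrite x1' x1.
  by move=> h; apply/Sigma0_oone/bigcup_open => n _; exact/Sigma0_oone.
have x1n : (xi <= oone)%O = false by apply/negbTE; rewrite -ltNge.
move=> h.
have /choice[G GP] : forall n, exists p : (nat -> set X) * (nat -> W),
    (forall i, [/\ (oone <= p.2 i)%O, (p.2 i < xi)%O & Pi0 (p.2 i) (p.1 i)]) /\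
    F n = \bigcup_i p.1 i.
  by move=> n; have := h n => /Sigma0E; rewrite x1n => -[f [z ?]]; exists (f, z).
apply/Sigma0E; rewrite x1n.
exists (fun m => (G (unpair m).1).1 (unpair m).2), (fun m => (G (unpair m).1).2 (unpair m).2).
split; first by move=> m; have [+ _] := GP (unpair m).1; exact.
apply/seteqP; split=> x [n _].
  have [_ ->] := GP n; move=> [i _ xi_]; exists (pickle (n, i)) => //.
  by rewrite pickleK_unpair.
by move=> xn; exists (unpair n).1 => //; have [_ ->] := GP (unpair n).1; exists (unpair n).2.
Qed.

Lemma Sigma0_bigcupI (T : Type) (I : set T) xi (F : T -> set X) :
  (oone <= xi)%O -> countable I ->
  (forall i, I i -> Sigma0 xi (F i)) -> Sigma0 xi (\bigcup_(i in I) F i).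
Proof.
move=> x1 /(bigcup_countable_seq F)[G [-> GP]] h; apply: Sigma0_bigcup => // n.
have [->|[i Ii ->]] := GP n; last exact: h.
by apply: Sigma0_open => //; exact: open0.
Qed.

Lemma Sigma0_setU xi A B : (oone <= xi)%O ->
  Sigma0 xi A -> Sigma0 xi B -> Sigma0 xi (A `|` B).
Proof.
move=> x1 SA SB; rewrite -bigcup2E; apply: Sigma0_bigcup => // -[|[|n]] //=.
by apply: Sigma0_open => //; exact: open0.
Qed.

Lemma Sigma0_setI xi A B : (oone <= xi)%O ->
  Sigma0 xi A -> Sigma0 xi B -> Sigma0 xi (A `&` B).
Proof.
move=> x1; have [x1'|x1'] := leP xi oone.
  have -> : xi = oone by apply/le_anti; rewrite x1' x1.
  by move=> /Sigma0_oone oA /Sigma0_oone oB; apply/Sigma0_oone; exact: openI.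
have x1n : (xi <= oone)%O = false by apply/negbTE; rewrite -ltNge.
move=> /Sigma0E; rewrite x1n => -[F [z [Fz ->]]].
move=> /Sigma0E; rewrite x1n => -[G [w [Gw ->]]].
rewrite setI_bigcupl; apply: Sigma0_bigcup => // i.
rewrite setI_bigcupr; apply: Sigma0_bigcup => // j.
have [z1 zx PF] := Fz i; have [w1 wx PG] := Gw j.
(* Each piece meets two Pi0 sets, so it is Pi0 at the larger of their levels, which is still below
   [xi]. *)
apply: (@Pi0_Sigma0 (Order.max (z i) (w j))); rewrite ?le_max ?z1 ?gt_max ?zx //.
rewrite /Pi0 /= setCI; apply: Sigma0_setU.
- by rewrite le_max z1.
- by apply: Pi0_le PF; rewrite ?le_max ?lexx.
- by apply: Pi0_le PG; rewrite ?le_max ?lexx ?orbT.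
Qed.

Definition borel A : Prop := exists xi, (oone <= xi)%O /\ Sigma0 xi A.

Lemma borel_open A : open A -> borel A.
Proof. by move=> oA; exists oone; split=> //; exact/Sigma0_oone. Qed.

Lemma borelC A : borel A -> borel (~` A).
Proof.
move=> [xi [x1 SA]]; exists (osucc xi); have [xs _] := osuccP xi.
split; first exact: le_trans (ltW xs).
by apply: (Pi0_Sigma0 x1 xs); rewrite /Pi0 /= setCK.
Qed.

Lemma borel_Pi0 A : borel A -> exists xi, (oone <= xi)%O /\ Pi0 xi A.
Proof. by move=> /borelC. Qed.

Lemma borel_bigcup (F : nat -> set X) :
  (forall n, borel (F n)) -> borel (\bigcup_n F n).
Proof.
move=> /choice[z zP].
(* Countably many levels have a common upper bound in [W]. *)
have [xi xP] := omega1_bounded (card_image_le z [set: nat]).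
have zx n : (z n < xi)%O by apply: xP; exists n.
have x1 : (oone <= xi)%O by have [? _] := zP 0%N; exact: le_trans (ltW (zx 0%N)).
exists xi; split=> //; apply: Sigma0_bigcup => // n.
by have [z1] := zP n; apply: Sigma0_le => //; exact: ltW.
Qed.

Lemma borel_bigcupI (T : Type) (I : set T) (F : T -> set X) :
  countable I ->
  (forall i, I i -> borel (F i)) -> borel (\bigcup_(i in I) F i).
Proof.
move=> /(bigcup_countable_seq F)[G [-> GP]] h; apply: borel_bigcup => n.
have [->|[i Ii ->]] := GP n; last exact: h.
exact/borel_open/open0.
Qed.

Lemma borel_bigcap (F : nat -> set X) :
  (forall n, borel (F n)) -> borel (\bigcap_n F n).
Proof.
move=> h; rewrite -[_ F]setCK setC_bigcap; apply/borelC/borel_bigcup => n.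
exact: borelC.
Qed.

Lemma borelI A B : borel A -> borel B -> borel (A `&` B).
Proof.
move=> bA bB; rewrite -bigcap2E; apply: borel_bigcap => -[|[|n]] //=.
exact/borel_open/openT.
Qed.

End Hierarchy.

(** * Cylinders and balls of the Baire space *)

Definition cylinder (n : nat) (a : baire_space) : set baire_space :=
  [set b | forall i, (i < n)%N -> b i = a i].

Lemma cylinder_open n a : open (cylinder n a).
Proof.
rewrite openE => b ba; apply/nbhs_baireP; exists n => c cb i i_n.
by rewrite cb // ba.
Qed.

Lemma cylinder_closed n a : closed (cylinder n a).
Proof.
rewrite -openC openE => b nba; apply/nbhs_baireP; exists n => c cb ca.
by apply: nba => i i_n; rewrite -cb // ca.
Qed.

Lemma open_coord (Q : set nat) k : open [set a : baire_space | Q (a k)].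
Proof.
rewrite openE => b Qb; apply/nbhs_baireP; exists k.+1 => c cb /=.
by rewrite cb.
Qed.

Section BaireBalls.
Variable R : realType.
Let ball := bnbhd (baire_presentation R).

Lemma baire_dist_eq (a b : baire_space) : a <> b ->
  exists n, baire_dist R a b = (n.+1%:R)^-1 /\ cylinder n a b.
Proof.
move=> ab; rewrite /baire_dist; case: pselect => [h|h].
  exists (ex_minn h); split=> // i.
  case: ex_minnP => n _ nP i_n; apply/eqP; apply: contraTT i_n.
  by rewrite eq_sym -leqNgt => /nP.
exfalso; apply: ab; apply/funext => n; apply: contrapT => /eqP nab.
by apply: h; exists n.
Qed.

(** Nonzero distances have the form 1/(n+1), so a ball of radius [q > 0] is the cylinder whose
    length is the least [m] with 1/(m+1) < q. *)
Lemma baire_ball_cylinder s :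
  ball s = set0 \/ exists m, ball s = cylinder m (seqproj (seqproj s 0)).
Proof.
set a : baire_space := seqproj (seqproj s 0).
set q := qrat R (seqproj s 1).
have ballE : ball s = [set x | baire_dist R a x < q] by [].
have [q0|q0] := leP q 0.
  left; apply/seteqP; split=> // x; rewrite ballE /= ltNge => /negP; apply.
  by apply: le_trans q0 _; have [h _ _ _] := baire_dist_metric R; exact: h.
right; have qm : exists m, m.+1%:R^-1 < q.
  exists (Num.bound q^-1); rewrite invf_plt ?posrE //.
  by apply: lt_trans (archi_boundP _) _; rewrite ?invr_ge0 ?(ltW q0) // ltr_nat.
case: (ex_minnP qm) => m mq mP; exists m; rewrite ballE.
apply/seteqP; split=> x /=.
  have [-> //|/baire_dist_eq[n [-> nx]]] := pselect (a = x).
  by move=> /mP mn i im; rewrite nx // (leq_trans im).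
(* Length 0 is separate, since [baire_distE] speaks of agreement on at least one coordinate; there
   all distances are at most 1 < q. *)
case: m mq mP => [|m] mq mP xa.
  have [->|/baire_dist_eq[n [-> nx]]] := pselect (a = x).
    have [_ h _ _] := baire_dist_metric R; by rewrite (h x x).2.
  by apply: le_lt_trans mq; rewrite lef_pV2 ?posrE // ler_nat.
have [->|/baire_dist_eq[n [e nx]]] := pselect (a = x).
  by have [_ h _ _] := baire_dist_metric R; rewrite (h x x).2.
have : baire_dist R a x < m.+1%:R^-1.
  by apply/baire_distE => i im; rewrite xa.
rewrite e ltf_pV2 ?posrE // ltr_nat => mn; apply: le_lt_trans mq.
by rewrite lef_pV2 ?posrE // ler_nat.
Qed.

Lemma cylinder_baire_ball n (a : baire_space) : exists s, ball s = cylinder n.+1 a.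
Proof.
(* The centre codes the first n+1 values of [a], and the radius is 1/(n+1). *)
exists (seqcode [:: seqcode (mkseq a n.+1); seqcode [:: 1%N; n]]).
apply/seteqP; rewrite /ball /bnbhd /= seqcodeK /qrat !seqcodeK /= mul1r.
split=> x /=.
  move=> /baire_distE xa i i_n.
  by rewrite -xa // seqcodeK nth_mkseq.
by move=> xa; apply/baire_distE => i i_n; rewrite xa // seqcodeK nth_mkseq.
Qed.

Lemma baire_ball_open s : open (ball s).
Proof.
by have [->|[m ->]] := baire_ball_cylinder s; [exact: open0|exact: cylinder_open].
Qed.

Lemma baire_ball_closed s : closed (ball s).
Proof.
by have [->|[m ->]] := baire_ball_cylinder s;
  [exact: closed0|exact: cylinder_closed].
Qed.

Lemma baire_ball_basis (A : set baire_space) a : open A -> A a ->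
  exists s, ball s a /\ ball s `<=` A.
Proof.
rewrite openE => oA /oA /nbhs_baireP[n nA].
have [s sE] := cylinder_baire_ball n a; exists s; rewrite sE; split=> //.
by move=> b ba; apply: nA => i i_n; apply: ba; rewrite ltnS ltnW.
Qed.

Lemma open_bigcup_ball (A : set baire_space) : open A ->
  A = \bigcup_(s in [set s | ball s `<=` A]) ball s.
Proof.
move=> oA; apply/seteqP; split=> a; last by move=> [s sA /sA].
by move=> /(baire_ball_basis oA)[s [sa sA]]; exists s.
Qed.

End BaireBalls.

(** Cylinders are closed, and finite sequences index only countably many of them. *)
Lemma baire_open_Fsigma (A : set baire_space) : open A ->
  exists F : nat -> set baire_space, (forall n, closed (F n)) /\ A = \bigcup_n F n.
Proof.
rewrite openE => oA.
pose C (u : seq nat) := cylinder (size u) (nth 0%N u).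
have [F [FE FP]] := bigcup_countable_seq C (countableP [set u | C u `<=` A]).
exists F; split.
  move=> n; have [->|[u _ ->]] := FP n; first exact: closed0.
  exact: cylinder_closed.
rewrite -FE; apply/seteqP; split=> a; last by move=> [u uA /uA].
move=> /oA/nbhs_baireP[n nA].
have CE : C (mkseq a n) = cylinder n a.
  rewrite /C size_mkseq; apply/seteqP.
  by split=> b ba i i_n; rewrite ba // nth_mkseq.
by exists (mkseq a n); rewrite /= CE.
Qed.

(** * The partial functions coded by points, Borelness of the sets of codes, and [apb] *)

Section PartialFunctions.
Variables (R : realType) (W : omega1) (P : presentation R (nat * nat)%type).
Let ball := bnbhd (baire_presentation R).
Implicit Types (a b : baire_space) (xi eta zeta : W).

Lemma Ucode_shift_open y : open [set a : baire_space | Ucode P (shift a) y].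
Proof.
have -> : [set a : baire_space | Ucode P (shift a) y] =
    \bigcup_k [set a : baire_space | bnbhd P (a k.+1) y].
  by apply/seteqP; split=> a; [move=> [k ?]; exists k|move=> [k _ ?]; exists k].
by apply: bigcup_open => k _; exact: (open_coord (fun i => bnbhd P i y)).
Qed.

(** Balls separate points, so the uniqueness clause in [defined] is automatic. *)
Lemma is_value_inj a n b b' : is_value P a n b -> is_value P a n b' -> b = b'.
Proof.
move=> h h'; apply/funext => i.
have [s sE] := cylinder_baire_ball R i b'.
have : ball s b by apply/h/h'; rewrite sE.
by rewrite /ball sE; exact.
Qed.

Lemma is_value_defined a n b : is_value P a n b -> defined P a n.
Proof. by move=> h; exists b; split=> // b'; exact: is_value_inj. Qed.

Lemma valueP a n : defined P a n -> is_value P a n (value P a n).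
Proof. by move=> [b [h _]]; exact: (xgetPex _ (ex_intro _ b h)). Qed.

Lemma value_eq a n b : is_value P a n b -> value P a n = b.
Proof. by move=> h; apply: is_value_inj (h); apply: valueP; exact: is_value_defined h. Qed.

Lemma value_ball a n s : defined P a n ->
  ball s (value P a n) <-> Ucode P a (n, s).
Proof. by move=> /valueP. Qed.

(* The balls accepted by [a] determine a point when they include arbitrarily
   long cylinders, pairwise meet, and are closed upwards; nothing more is needed
   since balls are closed. *)
Lemma definedE a n : defined P a n <->
  [/\ forall l, exists s, Ucode P a (n, s) /\ exists b, ball s = cylinder l.+1 b,
      forall s t, Ucode P a (n, s) -> Ucode P a (n, t) -> ball s `&` ball t !=set0 &
      forall s t, ball s `<=` ball t -> Ucode P a (n, s) -> Ucode P a (n, t)].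
Proof.
split=> [d|[cyl meet up]].
  split.
  - move=> l; have [s sE] := cylinder_baire_ball R l (value P a n); exists s.
    by split; [apply/value_ball => //; rewrite /ball sE|exists (value P a n)].
  - move=> s t /(value_ball _ d) hs /(value_ball _ d) ht.
    by exists (value P a n).
  - by move=> s t st /(value_ball _ d) /st /(value_ball _ d).
have /choice[p pP] : forall l, exists p : nat * baire_space,
    Ucode P a (n, p.1) /\ ball p.1 = cylinder l.+1 p.2.
  by move=> l; have [s [us [b sb]]] := cyl l; exists (s, b).
pose c l : baire_space := (p l).2.
have cc l m i : (i <= l)%N -> (i <= m)%N -> c l i = c m i.
  move=> il im; have [ul el] := pP l; have [um em] := pP m.
  by have [x] := meet _ _ ul um; rewrite el em => -[xl xm]; rewrite /c -xl // -xm.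
(* Accepted cylinders meet pairwise, so their centres agree on common coordinates and the diagonal
   lies in all of them. *)
pose b : baire_space := fun i => c i i.
have bc l : cylinder l.+1 b = ball (p l).1.
  have [_ ->] := pP l; apply/seteqP; split=> x xb i il; rewrite xb //.
    by rewrite /b (cc i l) // -ltnS.
  by rewrite /b [in RHS](cc i l) // -ltnS.
apply: (@is_value_defined _ _ b) => s; split.
  rewrite -/(ball s) => /[dup] bs.
  have : open (ball s) by exact: baire_ball_open.
  rewrite openE => /[apply] /nbhs_baireP[l lP].
  have [+ _] := pP l; apply: up; rewrite -bc => x xb; apply: lP => i il.
  by apply: xb; rewrite ltnS ltnW.
move=> us; apply: contrapT => nb.
have : open (~` ball s) by rewrite openC; exact: baire_ball_closed.
rewrite openE => /(_ b nb) /nbhs_baireP[l lP].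
have [ul _] := pP l; have [x [xl xs]] := meet _ _ ul us.
move: xl; rewrite -bc => xl; apply: (lP x) => // i il.
by apply: xl; rewrite ltnS ltnW.
Qed.

(** By [definedE] only quantifiers over numbers and the open conditions [Ucode P (shift a) y]
    remain; the geometry of the balls enters through the index sets. *)
Lemma borel_defined n : borel W [set a : baire_space | defined P (shift a) n].
Proof.
have bU y : borel W [set a : baire_space | Ucode P (shift a) y].
  by apply: borel_open; exact: Ucode_shift_open.
have bF := @baire_open_Fsigma.
have -> : [set a : baire_space | defined P (shift a) n] =
    \bigcap_l \bigcup_(s in [set s | exists b, ball s = cylinder l.+1 b])
      [set a : baire_space | Ucode P (shift a) (n, s)] `&`
    ~` (\bigcup_(st in [set st : nat * nat | ball st.1 `&` ball st.2 = set0])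
      ([set a : baire_space | Ucode P (shift a) (n, st.1)] `&`
       [set a : baire_space | Ucode P (shift a) (n, st.2)])) `&`
    ~` (\bigcup_(st in [set st : nat * nat | ball st.1 `<=` ball st.2])
      ([set a : baire_space | Ucode P (shift a) (n, st.1)] `&`
       ~` [set a : baire_space | Ucode P (shift a) (n, st.2)])).
  apply/seteqP; split=> a.
    move=> /definedE[h1 h2 h3]; split; first split.
    - by move=> l _; have [s [us sb]] := h1 l; exists s.
    - move=> [[s t] /= st0 [us ut]].
      by have := h2 _ _ us ut; rewrite st0 => -[].
    - by move=> [[s t] /= st [us]]; apply; exact: h3 us.
  move=> [[h1 h2] h3]; apply/definedE; split.
  - by move=> l; have [s sb us] := h1 l I; exists s.
  - move=> s t us ut; apply/set0P/negP => /eqP st0.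
    by apply: h2; exists (s, t).
  - move=> s t st us; apply: contrapT => nt.
    by apply: h3; exists (s, t).
do 2?[apply: borelI => //].
- by apply: borel_bigcap => // l; exact: borel_bigcupI.
- apply: borelC; apply: borel_bigcupI => //.
  by move=> i _; exact: borelI.
- apply: borelC; apply: borel_bigcupI => //.
  by move=> i _; apply: borelI => //; exact: borelC.
Qed.

(* [a |-> {a^*}(n)] is continuous on its domain, so that preimages stay in the
   same class relative to the domain. *)
Lemma Sigma0_value n xi (Q : set baire_space) : (oone <= xi)%O -> Sigma0 xi Q ->
  exists2 Q' : set baire_space, Sigma0 xi Q' &
    forall a, defined P (shift a) n -> (Q (value P (shift a) n) <-> Q' a).
Proof.
elim/(well_founded_ind (@omega1_wf W)): xi Q => xi IH Q x1.
move=> /Sigma0E; case: ifPn => [x1' oQ|x1' [F [z [FP ->]]]].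
  exists (\bigcup_(s in [set s | ball s `<=` Q])
            [set a : baire_space | Ucode P (shift a) (n, s)]).
    apply/Sigma0E; rewrite x1'; apply: bigcup_open => s _; exact: Ucode_shift_open.
  move=> a d; rewrite {1}(open_bigcup_ball R oQ).
  by split=> -[s sQ us]; exists s => //; apply/(value_ball _ d).
have /choice[G GP] : forall k, exists G, Pi0 (z k) G /\
    forall a, defined P (shift a) n -> (F k (value P (shift a) n) <-> G a).
  move=> k; have [z1 zx PF] := FP k.
  have [G SG GP] := IH _ zx _ z1 PF.
  exists (~` G); split; first by rewrite /Pi0 /= setCK.
  by move=> a /GP h; split=> [Fk /h //|ng]; apply: contrapT => /h.
exists (\bigcup_k G k).
  apply/Sigma0E; rewrite (negbTE x1'); exists G, z; split=> // k.
  by have [? ? _] := FP k; have [? _] := GP k.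
by move=> a d; split=> -[k _ h]; exists k => //; apply/(GP k).2.
Qed.

Lemma BC_oneP xi a : (oone <= xi)%O -> BC P xi a <->
  a 0%N = 1%N /\ forall n, exists zeta : W,
    [/\ (zeta < xi)%O, defined P (shift a) n & BC P zeta (value P (shift a) n)].
Proof. by rewrite oone_leP => /negbTE x0; rewrite BCE x0. Qed.

(** By induction, each clause [BC P zeta] on the [n]-th value pulls back to a Borel set; then one
    takes a union over the countably many [zeta < xi] and an intersection over [n]. *)
Lemma borel_BC xi : borel W (BC P xi).
Proof.
have bF := @baire_open_Fsigma.
elim/(well_founded_ind (@omega1_wf W)): xi => xi IH.
have [x0|x0] := eqVneq xi ozero.
  apply: borel_open.
  have -> : BC P xi = [set a : baire_space | a 0%N = 0%N].
    by apply/seteqP; split=> a; rewrite /= BCE x0 eqxx.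
  exact: (open_coord (fun i => i = 0%N)).
have : forall nz : nat * W, exists Q, (nz.2 < xi)%O -> borel W Q /\
    forall a, defined P (shift a) nz.1 ->
      (BC P nz.2 (value P (shift a) nz.1) <-> Q a).
  move=> [n zeta] /=.
  have [zx|] := boolP (zeta < xi)%O; last by exists set0.
  have [eta [e1 SB]] := IH _ zx.
  have [Q SQ QP] := Sigma0_value n e1 SB.
  by exists Q => _; split=> //; exists eta.
move=> /choice[Q QP].
have -> : BC P xi = [set a : baire_space | a 0%N = 1%N] `&`
    \bigcap_n ([set a : baire_space | defined P (shift a) n] `&`
      \bigcup_(zeta in [set zeta | (zeta < xi)%O]) Q (n, zeta)).
  apply/seteqP; split=> a.
    move=> /(BC_oneP _ (eqbRL (oone_leP _) x0))[a1 h]; split=> // n _.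
    have [zeta [zx d b]] := h n; split=> //; exists zeta => //.
    by apply/(QP (n, zeta) zx).2.
  move=> [a1 h]; apply/(BC_oneP _ (eqbRL (oone_leP _) x0)); split=> // n.
  have [d [zeta zx q]] := h n I; exists zeta; split=> //.
  by apply/(QP (n, zeta) zx).2.
apply: borelI => //.
  by apply: borel_open; exact: (open_coord (fun i => i = 1%N)).
apply: borel_bigcap => // n; apply: borelI => //; first exact: borel_defined.
apply: borel_bigcupI => //; first exact: omega1_countable.
by move=> zeta zx; have [] := QP (n, zeta) zx.
Qed.

(** By [borel_BC] the set whose least element defines [rbc] is nonempty, so the unspecified value of
    [oleast] does not occur. *)
Lemma rbcP xi : (oone <= rbc P xi)%O /\ Pi0 (rbc P xi) (BC P xi).
Proof.
have [|] := @oleastP W [set eta | (oone <= eta)%O /\ Pi0 eta (BC P xi)] => //.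
exact: borel_Pi0 (borel_BC xi).
Qed.

Lemma apb_ge1 xi : (oone <= apb P xi)%O.
Proof.
rewrite apbE; case: ifP => // _; rewrite oone_leP.
by have [h _] := osuccP (osup [set z | exists eta : W,
      [/\ (oone <= eta)%O, (eta < xi)%O
        & z = Order.max (apb P eta) (osucc (rbc P eta))]]);
  rewrite gt_eqF // (le_lt_trans (ozero_le _) h).
Qed.

(** The supremum defining [apb P xi] ranges over an image of a countable initial segment, so it is a
    true upper bound, and the final successor makes both inequalities strict. *)
Lemma apb_gt eta xi : (oone <= eta)%O -> (eta < xi)%O ->
  (apb P eta < apb P xi)%O /\ (rbc P eta < apb P xi)%O.
Proof.
move=> e1 ex; rewrite [apb P xi]apbE leNgt (le_lt_trans e1 ex) /=.
set A := [set z | _].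
have cA : countable A.
  apply: (@sub_countable _ _ _ ((fun eta => Order.max (apb P eta) (osucc (rbc P eta)))
     @` [set eta : W | (eta < xi)%O])).
    by apply: subset_card_le => _ [z [_ zx ->]]; exists z.
  apply: sub_countable (omega1_countable xi); exact: card_image_le.
have : (Order.max (apb P eta) (osucc (rbc P eta)) <= osup A)%O.
  by apply: osup_ub => //; exists eta.
have [h _] := osuccP (osup A); rewrite ge_max => /andP[h1 h2].
split; first exact: le_lt_trans h.
have [h3 _] := osuccP (rbc P eta); apply: lt_trans h3 _; exact: le_lt_trans h.
Qed.

End PartialFunctions.

(** * Equality modulo meager sets and its compatibility with complements and countable unions *)

Section Meager.
Variable X : topologicalType.
Implicit Types A B : set X.

Lemma meager_sub A B : A `<=` B -> meager B -> meager A.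
Proof. by move=> AB [F [ndF BF]]; exists F; split=> //; exact: subset_trans BF. Qed.

Lemma meager0 : meager (@set0 X).
Proof.
exists (fun=> set0); split=> // _; rewrite /nowhere_dense closure0.
exact: interior0.
Qed.

Lemma meager_bigcup (F : nat -> set X) :
  (forall n, meager (F n)) -> meager (\bigcup_n F n).
Proof.
move=> /choice[G GP].
exists (fun m => G (unpair m).1 (unpair m).2); split.
  by move=> m; have [h _] := GP (unpair m).1; exact: h.
move=> x [n _ Fx]; have [_ /(_ x Fx)[i _ Gx]] := GP n.
by exists (pickle (n, i)) => //; rewrite pickleK_unpair.
Qed.

Lemma meagerU A B : meager A -> meager B -> meager (A `|` B).
Proof.
move=> mA mB; rewrite -bigcup2E; apply: meager_bigcup => -[|[|n]] //=.
exact: meager0.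
Qed.

Lemma meager_setY_trans A B C :
  meager (A `+` B) -> meager (B `+` C) -> meager (A `+` C).
Proof.
move=> mAB mBC; apply: meager_sub (meagerU mAB mBC) => x.
by rewrite /setY; have [Bx|Bx] := pselect (B x) => -[[Ax Cx]|[Cx Ax]];
  [right; left|left; right|left; left|right; right].
Qed.

Lemma meager_setY_setC A B : meager (A `+` B) -> meager (~` A `+` ~` B).
Proof.
by apply: meager_sub => x; rewrite /setY => -[] [h /contrapT h']; [right|left].
Qed.

Lemma meager_setY_bigcup (F G : nat -> set X) :
  (forall n, meager (F n `+` G n)) -> meager (\bigcup_n F n `+` \bigcup_n G n).
Proof.
move=> /meager_bigcup; apply: meager_sub => x; rewrite /setY.
move=> [[[n _ h] ng]|[[n _ h] ng]]; exists n => //; rewrite /setY; [left|right];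
  by split=> // g; apply: ng; exists n.
Qed.

End Meager.

(** * Basic balls of a presented space and codes for exteriors of open sets *)

Section OpenCodes.
Variables (R : realType) (X : topologicalType) (D : presentation R X).
Hypothesis hD : is_presentation D.

Lemma bnbhd_open s : open (bnbhd D s).
Proof.
have [[[_ _ _ tri] cm] _] := hD; apply/cm => x.
rewrite /bnbhd /=; set q := qrat R _; set p := ppoint D _ => px.
exists (q - pdist D p x); first by rewrite subr_gt0.
move=> y /= xy; apply: le_lt_trans (tri p x y) _.
by rewrite -ltrBrDl.
Qed.

(** A product of prime powers is never 0, so the projections of 0 all take the default 0 and the
    radius is 0. *)
Lemma bnbhd0 : bnbhd D 0 = set0.
Proof.
have n0 i : seqproj 0 i = 0%N.
  rewrite /seqproj; case: xgetP => [u -> us|]; last by rewrite nth_nil.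
  move: us; rewrite /= /seqcode => /eqP.
  by rewrite -leqn0 leqNgt prodn_gt0 // => j; rewrite expn_gt0 prime_gt0 ?nth_prime_prime.
have [[[ge0 _ _ _] _] _] := hD.
apply/seteqP; split=> // x; rewrite /bnbhd /= /qrat !n0 mul0r.
by move=> /lt_geF; rewrite ge0.
Qed.

Lemma Ucode_open a : open (Ucode D a).
Proof.
have -> : Ucode D a = \bigcup_n bnbhd D (a n).
  by apply/seteqP; split=> x; [move=> [n ?]; exists n|move=> [n _ ?]; exists n].
by apply: bigcup_open => n _; exact: bnbhd_open.
Qed.

Lemma bnbhd_basis (O : set X) x : open O -> O x ->
  exists s, bnbhd D s x /\ bnbhd D s `<=` O.
Proof.
have [[[ge0 d0 sym tri] cm] dn] := hD => oO Ox.
have [e e0 eO] := (cm O).1 oO x Ox.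
(* A centre within 1/(m+1) of [x] and the radius 1/(m+1), both below e/2, keep the ball inside the
   [e]-ball about [x]. *)
have [m me] : exists m, m.+1%:R^-1 < e / 2.
  have e20 : 0 < e / 2 by rewrite divr_gt0.
  exists (Num.bound (e / 2)^-1); rewrite invf_plt ?posrE //.
  by apply: lt_trans (archi_boundP _) _; rewrite ?invr_ge0 ?(ltW e20) // ltr_nat.
have oB : open [set y | pdist D x y < m.+1%:R^-1].
  apply/cm => y /= xy; exists (m.+1%:R^-1 - pdist D x y); first by rewrite subr_gt0.
  by move=> z /= yz; apply: le_lt_trans (tri x y z) _; rewrite -ltrBrDl.
have [|z [xz [i _ iz]]] := dn _ _ oB.
  by exists x; rewrite /= (d0 x x).2 // invr_gt0.
move: xz; rewrite -iz => xr; exists (seqcode [:: i; seqcode [:: 1%N; m]]).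
rewrite /bnbhd /= !seqcodeK /= /qrat !seqcodeK /= mul1r; split.
  by rewrite sym.
move=> y /= ry; apply: eO => /=; apply: le_lt_trans (tri x (ppoint D i) y) _.
by rewrite (splitr e) ltrD // (lt_trans _ me).
Qed.

(* Index 0 codes the empty ball. *)
Definition ext_code (a : baire_space) : baire_space := fun k =>
  if `[< bnbhd D k `&` Ucode D a !=set0 >] then 0%N else k.

Lemma ext_codeE a x : Ucode D (ext_code a) x <->
  exists k, bnbhd D k x /\ ~ (bnbhd D k `&` Ucode D a !=set0).
Proof.
split=> [[k]|[k [kx nk]]].
  rewrite /ext_code; case: asboolP => [|nk kx]; first by rewrite bnbhd0.
  by exists k.
by exists k; rewrite /ext_code; case: asboolP.
Qed.

(** An open set and its exterior are disjoint with dense union, so complement and exterior differ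
    exactly by the closed nowhere dense rest. *)
Lemma ext_code_meager a : meager (~` Ucode D a `+` Ucode D (ext_code a)).
Proof.
exists (fun=> ~` (Ucode D a `|` Ucode D (ext_code a))); split.
  move=> _; rewrite /nowhere_dense -(closure_id _).1; last first.
    by apply: open_closedC; apply: openU; exact: Ucode_open.
  rewrite interiorC; apply/seteqP; split=> // x nx; apply: nx.
  move=> O Ox.
  have [s [sx sO]] := bnbhd_basis (@open_interior _ O) Ox.
  have [[y [sy ya]]|ns] := pselect (bnbhd D s `&` Ucode D a !=set0).
    by exists y; split; [left|apply: interior_subset; exact: sO].
  exists x; split; last by apply: interior_subset; exact: sO.
  by right; apply/ext_codeE; exists s.
move=> x; rewrite /setY => -[[na ne]|[/ext_codeE[k [kx nk]] /contrapT xa]].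
  by exists 0%N => // -[].
by exfalso; apply: nk; exists x.
Qed.

(** A ball meets the coded set iff it meets one of the listed balls, which is a condition on a
    single coordinate of [a]. *)
Lemma meets_open k :
  open [set a : baire_space | bnbhd D k `&` Ucode D a !=set0].
Proof.
have -> : [set a : baire_space | bnbhd D k `&` Ucode D a !=set0] =
    \bigcup_i [set a : baire_space | bnbhd D k `&` bnbhd D (a i) !=set0].
  apply/seteqP; split=> a.
    by move=> [x [kx [i ix]]]; exists i => //; exists x.
  by move=> [i _ [x [kx ix]]]; exists x; split=> //; exists i.
apply: bigcup_open => i _.
exact: (open_coord (fun j => bnbhd D k `&` bnbhd D j !=set0)).
Qed.

End OpenCodes.

(** * The function from Borel codes to open codes *)

Section Uniformization.
Variables (R : realType) (W : omega1) (P : presentation R (nat * nat)%type).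
Variables (X : topologicalType) (D : presentation R X).
Hypotheses (hP : is_presentation P) (hD : is_presentation D).
Implicit Types (a b c : baire_space) (xi eta zeta : W).
Local Notation val a n := (value P (shift a) n).

(** Coordinate [m] stands for a pair [(n, k)] and lists the [k]-th ball for the complement of the
    set coded by the [n]-th value [b]. The test on [b 0] detects rank 0, where that complement is
    the ball [b 1], listed for every [k]. *)
Definition open_code_rec : W -> baire_space -> baire_space :=
  orec (fun=> (fun=> 0%N) : baire_space) (fun xi S a m =>
    let b := val a (unpair m).1 in
    if b 0%N == 0%N then b 1%N
    else ext_code D (S (rank W P b) b) (unpair m).2).

Definition open_code a : baire_space := open_code_rec (rank W P a) a.

Lemma BC_rank xi a : BC P xi a -> BC P (rank W P a) a /\ (rank W P a <= xi)%O.
Proof.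
by move=> h; have [? le] := @oleastP W [set xi | BC P xi a] (ex_intro _ xi h);
  split=> //; exact: le.
Qed.

(** Coordinate 0 is a tag: a code at level zero belongs to no other level. *)
Lemma BC_ozeroE xi a : BC P xi a -> (xi == ozero) = (a 0%N == 0%N).
Proof.
by move=> /BCE; case: eqP => _ => [->|[->]].
Qed.

(** The right-hand side mentions no level, which is why one function serves all of them. [rank_lt]
    keeps the recursive call away from the default of [orec]. *)
Lemma open_codeE xi a m : BC P xi a -> (oone <= xi)%O ->
  open_code a m =
  let b := val a (unpair m).1 in
  if b 0%N == 0%N then b 1%N else ext_code D (open_code b) (unpair m).2.
Proof.
move=> h; rewrite oone_leP (BC_ozeroE h) => a0.
have [hr _] := BC_rank h.
rewrite {1}/open_code /open_code_rec orecE /= rank_lt //.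
by rewrite (BC_ozeroE hr).
Qed.

Lemma open_code_meager xi a : (oone <= xi)%O -> BC P xi a ->
  meager (Bcode P D xi a `+` Ucode D (open_code a)).
Proof.
elim/(well_founded_ind (@omega1_wf W)): xi a => xi IH a x1 h.
have [hr _] := BC_rank h.
have -> : Bcode P D xi a = \bigcup_n ~` pi_code P D (rank W P (val a n)) (val a n).
  rewrite -[RHS](_ : pi_code P D (rank W P a) a = _).
    by apply/seteqP; split=> [x []|x].
  by rewrite pi_codeE // (BC_ozeroE hr) -(BC_ozeroE h) -(negbK (xi == _)) -oone_leP x1.
(* Grouping the balls by [n] matches the union in [pi_code]. An [m] need not be a pickled pair, but
   its ball depends only on [unpair m]. *)
have -> : Ucode D (open_code a) =
    \bigcup_n \bigcup_k bnbhd D (open_code a (pickle (n : nat, k : nat))).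
  apply/seteqP; split=> x.
    move=> [m mx]; exists (unpair m).1 => //; exists (unpair m).2 => //.
    move: mx; rewrite !(open_codeE _ h x1) /= pickleK_unpair.
    by [].
  by move=> [n _ [k _ xk]]; exists (pickle (n, k)).
apply: meager_setY_bigcup => n.
have [_ /(_ n)[zeta [zx _ hz]]] := (BC_oneP P a x1).1 h.
set b := val a n in hz *.
have [hb rz] := BC_rank hz.
have codeE k : open_code a (pickle (n, k)) =
    if b 0%N == 0%N then b 1%N else ext_code D (open_code b) k.
  by rewrite (open_codeE _ h x1) pickleK_unpair.
under eq_bigcupr do rewrite codeE.
rewrite pi_codeE // (BC_ozeroE hb).
have [b0|b0] := eqVneq (b 0%N) 0%N.
  rewrite setCK bigcup_const; last by exists 0%N.
  by rewrite setYK; exact: meager0.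
have z1 : (oone <= zeta)%O by rewrite oone_leP (BC_ozeroE hz).
have -> : \bigcup_k bnbhd D (ext_code D (open_code b) k) =
    Ucode D (ext_code D (open_code b)).
  by apply/seteqP; split=> x; [move=> [k _ ?]|move=> [k ?]]; exists k.
(* The complement of the set coded by [b] is compared by induction with the complement of
   [Ucode D (open_code b)], and that one with the exterior. *)
apply: meager_setY_trans (ext_code_meager hD (open_code b)).
apply: meager_setY_setC.
have := IH _ zx _ z1 hz; congr (meager (_ `+` _)).
have := pi_codeE D hb; rewrite (BC_ozeroE hb) (negbTE b0) => <-.
by apply/seteqP; split=> [x []|x].
Qed.

(** The coordinate depends only on the value [val a n]. Rank 0 makes it a coordinate of that value;
    otherwise it is 0 or [k] according to an open condition on the open code of the value, which the
    assumption handles at each [eta < xi]. *)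
Lemma open_code_coord xi m j : (oone <= xi)%O ->
  (forall eta (V : set baire_space), (eta < xi)%O -> (oone <= eta)%O -> open V ->
    exists2 B : set baire_space, Sigma0 (apb P eta) B &
      forall a, BC P eta a -> (V (open_code a) <-> B a)) ->
  exists2 B : set baire_space, Sigma0 (apb P xi) B &
    forall a, BC P xi a -> (open_code a m = j <-> B a).
Proof.
move=> x1 IH; have bF := @baire_open_Fsigma; have ax1 := apb_ge1 P xi.
move E : (unpair m) => [n k].
have /choice[w wP] : forall eta, exists w, (eta < xi)%O -> (oone <= eta)%O ->
    Sigma0 (apb P eta) w /\ forall b, BC P eta b ->
      (bnbhd D k `&` Ucode D (open_code b) !=set0 <-> w b).
  move=> eta; have [/andP[ex e1]|ne] := boolP ((eta < xi)%O && (oone <= eta)%O).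
    by have [w] := IH _ _ ex e1 (meets_open D k); exists w.
  by exists set0 => ex e1; rewrite ex e1 in ne.
(* On [BC P eta], [w eta] says that the [k]-th ball meets the open set; [ext_code] then answers 0,
   and [k] otherwise. *)
pose Q eta : set baire_space := BC P eta `&`
  ((w eta `&` [set _ | j = 0%N]) `|` (~` w eta `&` [set _ | j = k])).
have /choice[Q' Q'P] : forall eta, exists Q', (eta < xi)%O -> (oone <= eta)%O ->
    Sigma0 (apb P xi) Q' /\ forall a, defined P (shift a) n ->
      (Q eta (val a n) <-> Q' a).
  move=> eta; have [/andP[ex e1]|ne] := boolP ((eta < xi)%O && (oone <= eta)%O);
    last by exists set0 => ex e1; rewrite ex e1 in ne.
  suff SQ : Sigma0 (apb P xi) (Q eta).
    by have [Q'] := Sigma0_value P n ax1 SQ; exists Q'.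
  (* The strict inequalities leave room below [apb P xi] for both [BC P eta] and the complement of
     [w eta]. *)
  have [Sw _] := wP _ ex e1; have [ae re] := apb_gt P e1 ex.
  have [r1 PBC] := rbcP P eta.
  have const (p : Prop) : Sigma0 (apb P xi) [set _ : baire_space | p].
    by apply: Sigma0_open => //; exact: (open_coord (fun _ => p) 0).
  apply: Sigma0_setI => //; first exact: Pi0_Sigma0 PBC.
  apply: Sigma0_setU => //; apply: Sigma0_setI => //.
    by apply: Sigma0_le Sw; rewrite ?apb_ge1 // ltW.
  by apply: (Pi0_Sigma0 (apb_ge1 P eta) ae); rewrite /Pi0 /= setCK.
have [Q0 SQ0 Q0P] : exists2 Q0 : set baire_space, Sigma0 (apb P xi) Q0 &
    forall a, defined P (shift a) n -> (val a n 0%N = 0%N /\ val a n 1%N = j <-> Q0 a).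
  apply: (Sigma0_value P n ax1 (Q := [set b | b 0%N = 0%N /\ b 1%N = j])).
  apply: Sigma0_open => //.
  apply: (@openI _ [set b : baire_space | b 0%N = 0%N] [set b : baire_space | b 1%N = j]).
    exact: (open_coord (fun i => i = 0%N)).
  exact: (open_coord (fun i => i = j)).
exists (Q0 `|` \bigcup_(eta in [set eta | (oone <= eta)%O && (eta < xi)%O]) Q' eta).
  apply: Sigma0_setU => //; apply: Sigma0_bigcupI => //.
    apply: sub_countable (omega1_countable xi).
    by apply: subset_card_le => eta /andP[].
  by move=> eta /andP[e1 ex]; have [] := Q'P _ ex e1.
move=> a h; rewrite (open_codeE _ h x1) E /=.
have [_ /(_ n)[zeta [zx d hz]]] := (BC_oneP P a x1).1 h.
have [b0|b0] := eqVneq (val a n 0%N) 0%N.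
  split=> [b1|]; first by left; apply/Q0P.
  move=> [/(Q0P _ d)[]//|[eta /andP[e1 ex] /((Q'P _ ex e1).2 _ d)[/BC_ozeroE]]].
  by rewrite b0 eqxx => e; move: e1; rewrite oone_leP e.
(* All [w eta] express the same condition, each on its own [BC P eta], so any level containing the
   value gives the same verdict. *)
have extE eta : (oone <= eta)%O -> (eta < xi)%O -> BC P eta (val a n) ->
    ext_code D (open_code (val a n)) k = j <-> Q' eta a.
  move=> e1 ex he; rewrite -((Q'P _ ex e1).2 _ d) /ext_code.
  have hw := (wP _ ex e1).2 _ he; rewrite /Q; case: asboolP => [/hw wb|/hw nwb].
    by split=> [<-|[_ [[_ ->]|[/(_ wb)]]]] //; split=> //; left.
  by split=> [<-|[_ [[/nwb]|[_ ->]]]] //; split=> //; right.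
split=> [ej|].
  have z1 : (oone <= zeta)%O by rewrite oone_leP (BC_ozeroE hz).
  by right; exists zeta; [apply/andP|apply/extE].
move=> [/(Q0P _ d)[/eqP]|[eta /andP[e1 ex] q]]; first by rewrite (negbTE b0).
by apply/(extE eta) => //; have [] := ((Q'P _ ex e1).2 _ d).2 q.
Qed.

(** The induction feeds [open_code_coord]. Cylinders are finite intersections of coordinate
    conditions, and open sets are countable unions of balls, each empty or a cylinder. *)
Lemma open_code_measurable xi (V : set baire_space) : (oone <= xi)%O -> open V ->
  exists2 B : set baire_space, Sigma0 (apb P xi) B &
    forall a, BC P xi a -> (V (open_code a) <-> B a).
Proof.
elim/(well_founded_ind (@omega1_wf W)): xi V => xi IH V x1 oV.
have bF := @baire_open_Fsigma; have ax1 := apb_ge1 P xi.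
have cyl n c : exists2 B : set baire_space, Sigma0 (apb P xi) B &
    forall a, BC P xi a -> (cylinder n c (open_code a) <-> B a).
  elim: n => [|n [B SB BP]].
    by exists setT => //; apply: Sigma0_open => //; exact: openT.
  have [B' SB' BP'] := @open_code_coord xi n (c n) x1 (fun eta V ex => IH eta ex V).
  exists (B `&` B'); first exact: Sigma0_setI.
  move=> a h; rewrite /setI /= -(BP _ h) -(BP' _ h); split.
    by move=> ca; split=> [i i_n|]; apply: ca => //; rewrite ltnS ltnW.
  by move=> [ca cn] i; rewrite ltnS leq_eqVlt => /orP[/eqP -> //|/ca].
have /choice[B BP] : forall s, exists B, Sigma0 (apb P xi) B /\ forall a, BC P xi a ->
    (bnbhd (baire_presentation R) s (open_code a) <-> B a).
  move=> s; have [->|[n ->]] := baire_ball_cylinder R s.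
    by exists set0; split=> //; apply: Sigma0_open => //; exact: open0.
  by have [B] := cyl n (seqproj (seqproj s 0)); exists B.
exists (\bigcup_(s in [set s | bnbhd (baire_presentation R) s `<=` V]) B s).
  apply: Sigma0_bigcupI => // s _; exact: (BP s).1.
move=> a h; rewrite {1}(open_bigcup_ball R oV).
by split=> -[s sV sa]; exists s => //; apply/((BP s).2 a h).
Qed.

(** The space of pairs is discrete, so its singletons are basic balls; [a] lists, after its first
    entry, those of the pairs [(n, t)] for which the [t]-th ball contains [b], and pads with the
    empty ball 0. *)
Lemma is_value_surj b : exists a, forall n, is_value P (shift a) n b.
Proof.
have ballP (p : nat * nat) : exists s, bnbhd P s = [set p].
  have op : open [set p].
    rewrite openE => _ ->; case: p => n m; exists ([set n], [set m]) => /=.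
      by split; exact: discrete_set1.
    by move=> [? ?] /= [-> ->].
  have [s [sp sE]] := bnbhd_basis hP op erefl.
  by exists s; apply/seteqP; split=> // _ ->.
have [s sP] := choice ballP.
pose a : baire_space := fun i =>
  if i is j.+1 then
    if `[< bnbhd (baire_presentation R) (unpair j).2 b >] then s (unpair j) else 0%N
  else 1%N.
exists a => n t; split=> [bt|[j]].
  exists (pickle (n, t)); rewrite /shift /= pickleK_unpair.
  by case: asboolP => // _; rewrite sP.
rewrite /shift /=; case: asboolP => [jb|_]; last by rewrite bnbhd0.
by rewrite sP /= => e; move: jb; rewrite -e.
Qed.

(** Supplies the nonempty domain demanded by [measurable_wrt]: all values of the witness are the
    zero sequence, a code of rank 0. *)
Lemma BC_nonempty xi : (oone <= xi)%O -> BC P xi !=set0.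
Proof.
move=> x1; have [a aP] := is_value_surj ((fun=> 0%N) : baire_space).
exists (fun i => if i is j.+1 then a i else 1%N); apply/(BC_oneP P _ x1).
split=> // n; exists ozero; rewrite lt_neqAle ozero_le eq_sym -oone_leP x1.
split=> //; first exact: is_value_defined (aP n).
by rewrite BCE eqxx (value_eq (aP n)).
Qed.

End Uniformization.

Theorem theorem8 (R : realType) (W : omega1)
    (P : presentation R (nat * nat)%type) (hP : recursive_presentation P)
    (X : topologicalType) (hX : polish R X)
    (D : presentation R X) (hD : is_presentation D) :
  exists c : W -> baire_space -> baire_space,
    (forall xi : W, (oone <= xi)%O ->
       measurable_wrt (Sigma0 (apb P xi)) (BC P xi) (c xi) /\
       forall alpha : baire_space, BC P xi alpha ->
         meager (Bcode P D xi alpha `+` Ucode D (c xi alpha))) /\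
    (forall eta xi : W, (otwo <= eta)%O -> (eta < xi)%O ->
       forall alpha : baire_space, BC P eta alpha -> c xi alpha = c eta alpha).
Proof.
have [hP' _ _] := hP.
(* The family is constant in [xi], which makes the coherence clause immediate. *)
exists (fun=> open_code W P D); split=> // xi x1; split; last first.
  by move=> a; exact: open_code_meager.
split; first exact: BC_nonempty.
move=> V oV; have [B SB BP] := open_code_measurable P D x1 oV; exists B => //.
by apply/seteqP; split=> a; [move=> [h /(BP _ h)]|move=> [+ h] => /(BP _ h)].
Qed.
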